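(* The star Menger property is not necessarily inherited by regular open subsets: there exist a star Menger space $X$ and a regular open subset $Y$ of $X$ such that $Y$, with the subspace topology, is not star Menger.
   Context: All spaces are assumed to be regular and $T_1$. For a family $\mathcal{U}$ of subsets of $X$ and $A\subseteq X$, $St(A,\mathcal{U})=\bigcup\{U\in\mathcal{U}:U\cap A\neq\emptyset\}$. A space $M$ is Menger if for every sequence $\{\mathcal{U}_n:n\in\omega\}$ of open covers of $M$ there are finite subcollections $\mathcal{V}_n\subseteq\mathcal{U}_n$ ($n\in\omega$) such that $\bigcup\{\mathcal{V}_n:n\in\omega\}$ is an open cover of $M$. A space $X$ is star Menger if for every open cover $\mathcal{U}$ of $X$ there is a subspace $M\subseteq X$ which is Menger and satisfies $St(M,\mathcal{U})=X$. A subset is regular open if it equals the interior of its closure. *)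

(* Defs.v *)
From mathcomp Require Import all_boot all_order.
From mathcomp Require Import all_classical all_reals all_analysis.

Set Implicit Arguments.
Unset Strict Implicit.
Unset Printing Implicit Defensive.

Local Open Scope classical_set_scope.

Definition open_cover (X : topologicalType) (U : set (set X)) : Prop :=
  U `<=` open /\ \bigcup_(A in U) A = [set: X].

Definition star (X : Type) (A : set X) (U : set (set X)) : set X :=
  \bigcup_(B in [set B | U B /\ B `&` A !=set0]) B.

Definition menger (X : topologicalType) : Prop :=
  forall U : nat -> set (set X), (forall n, open_cover (U n)) ->
  exists V : nat -> set (set X),
    (forall n, V n `<=` U n /\ finite_set (V n)) /\
    open_cover (\bigcup_n V n).

(* The library's topology on [set_type M] is the initial topology of the
   inclusion, i.e. the subspace topology; [subspace M] would not do, since it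
   keeps the points outside M as isolated points. *)
Definition star_menger (X : topologicalType) : Prop :=
  forall U : set (set X), open_cover U ->
  exists M : set X, menger (set_type M) /\ star M U = [set: X].

(* Main.v *)
Require Import Defs.
From HB Require Import structures.
From mathcomp Require Import finmap.
From mathcomp Require Import all_boot all_order.
From mathcomp Require Import all_classical all_reals all_analysis.

Set Implicit Arguments.
Unset Strict Implicit.
Unset Printing Implicit Defensive.

Local Open Scope classical_set_scope.

(** Let X be the one-point compactification of an uncountable discrete space T
    and Y a set of isolated points that is uncountable and has infinite
    complement in T. Neighbourhoods of the point at infinity meet T \ Y, so Y
    is regular open. The compact space X is star Menger, while the cover of Y
    by singletons only has Y itself as a star kernel, and an uncountable
    discrete space is not Menger. *)

(** Compactness of [K] speaks of open sets of [X], so the members of the first cover are enlarged to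
    such sets. Finitely many of them already cover [K], and every later selection can be empty. *)
Lemma compact_menger (X : ptopologicalType) (K : set X) :
  compact K -> menger (set_type K).
Proof.
rewrite compact_cover => cK U coverU.
have [oU0 U0T] := coverU 0.
(* The largest open subset of X whose trace on K is A, if A is open in K. *)
pose ext (A : set K) := \bigcup_(G in [set G | open G /\ set_val @^-1` G = A]) G.
have ext_open A : U 0 A -> open (ext A).
  by move=> _; apply: bigcup_open => G [].
have ext_cover : K `<=` cover (U 0) ext.
  move=> x Kx; pose k : K := exist _ x (mem_set Kx).
  have [A U0A Ak] : (\bigcup_(A in U 0) A) k by rewrite U0T.
  have [G oG GA] := oU0 _ U0A; exists A => //; exists G => //.
  by move: Ak; rewrite -GA.
have [D DU0 KD] := cK _ _ _ ext_open ext_cover.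
pose V n := if n is 0 then [set` D] else set0.
exists V; split=> [[|n] /=|].
- by split=> [A /DU0/set_mem|] //; exact: finite_fset.
- by split=> [A|] //; exact: finite_set0.
split=> [A [[|n] _ //=] /DU0/set_mem/oU0//|].
apply/seteqP; split=> // k _.
have [A DA [G [_ GA] Gk]] := KD _ (set_valP k).
by exists A; [exists 0|rewrite -GA].
Qed.

Lemma compact_star_menger (X : ptopologicalType) :
  compact [set: X] -> star_menger X.
Proof.
move=> cX U [_ UT]; exists setT; split; first exact: compact_menger.
apply/seteqP; split=> // x _.
have [A UA Ax] : (\bigcup_(A in U) A) x by rewrite UT.
by exists A => //; split=> //; exists x.
Qed.

Lemma open_cover_set1 (X : topologicalType) :
  (forall x : X, open [set x]) -> open_cover (range (@set1 X)).
Proof.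
move=> o1; split=> [_ [x _ <-]//|]; apply/seteqP; split=> // x _.
by exists [set x]; [exists x|].
Qed.

Lemma open_set1_set_type (X : topologicalType) (Y : set X) :
  (forall y, Y y -> open [set y]) -> forall y : Y, open [set y].
Proof.
move=> o1 y; have -> : [set y] = set_val @^-1` [set set_val y].
  by apply/seteqP; split=> z /= => [->//|/val_inj].
by exists [set set_val y] => //; apply/o1/set_valP.
Qed.

(** For the constant sequence of covers by singletons, a Menger selection names finitely many points
    at each stage, hence countably many in total. *)
Lemma menger_set1_countable (X : topologicalType) (Y : set X) :
  (forall y, Y y -> open [set y]) -> menger (set_type Y) -> countable Y.
Proof.
move=> /open_set1_set_type o1.
move=> /(_ (fun=> range set1) (fun=> open_cover_set1 o1)) [V [V1 [_ VT]]].
have <- : set_val @` [set: Y] = Y.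
  apply/seteqP; split=> [_ [y _ <-]|y Yy]; first exact: set_valP.
  by exists (exist _ y (mem_set Yy)).
apply: sub_countable (card_image_le _ _) _; rewrite -VT bigcup_bigcup.
apply: bigcup_countable => // n _.
apply: bigcup_countable => [|A /(proj1 (V1 n))[x _ <-]]; last exact: countable1.
by apply: finite_set_countable; case: (V1 n).
Qed.

Lemma star_menger_set1_countable (X : topologicalType) (Y : set X) :
  (forall y, Y y -> open [set y]) -> star_menger (set_type Y) -> countable Y.
Proof.
move=> o1 starY; have o1Y := open_set1_set_type o1.
have [M [mM starM]] := starY _ (open_cover_set1 o1Y).
(* A singleton meets [M] only if its point lies in [M], so the star of [M] is [M] itself. *)
have MT : M = setT.
  apply/seteqP; split=> // y _; have : star M (range set1) y by rewrite starM.
  by move=> [_ [[z _ <-] [_ [-> Mz]]] ->].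
have <- : set_val @` M = Y.
  rewrite MT; apply/seteqP; split=> [_ [y _ <-]|y Yy]; first exact: set_valP.
  by exists (exist _ y (mem_set Yy)).
apply: sub_countable (card_image_le _ _) _.
by apply: menger_set1_countable mM => y _; exact: o1Y.
Qed.

Lemma compact_discrete_finite (T : pdiscreteTopologicalType) (K : set T) :
  compact K -> finite_set K.
Proof.
rewrite compact_cover => /(_ T setT set1).
case=> [x _|x _|D _ KD]; [exact: discrete_open|by exists x|].
by apply: sub_finite_set (finite_fset D) => x /KD [y Dy ->].
Qed.

Section discrete_one_point_compactification.
Variable T : pdiscreteTopologicalType.
Local Notation opc := (one_point_compactification T).

Lemma open_Some1 (x : T) : open [set (Some x : opc)].
Proof.
rewrite -image_set1; exact/one_point_compactification_open_some/discrete_open.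
Qed.

Lemma regopen_Some (A : set T) :
  infinite_set (~` A) -> regopen (Some @` A : set opc).
Proof.
have closA y : closure (Some @` A : set opc) (Some y) -> A y.
  move=> /(_ [set Some y]) []; last by move=> _ [[x Ax <-] [<-]].
  by apply: open_nbhs_nbhs; split=> //; exact: open_Some1.
move=> infA; apply/seteqP; split=> [[y|]|].
- by move=> /nbhs_singleton/closA Ay; exists y.
(* A neighbourhood of infinity omits only a compact, hence finite, set [W] of isolated points. If it
   lay in the closure, [W] would contain the whole complement of [A]. *)
- move=> [W [/compact_discrete_finite finW _] WA]; exfalso; apply: infA.
  apply: sub_finite_set finW => y nAy; apply: contrapT => nWy; apply: nAy.
  by apply/closA/WA; left; exists y.
rewrite -open_subsetE; first exact: subset_closure.
exact/one_point_compactification_open_some/discrete_open.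
Qed.

Lemma discrete_one_point_compactification_hausdorff : hausdorff_space opc.
Proof.
apply: one_point_compactification_hausdorff; last exact: discrete_hausdorff.
(* Local compactness: a singleton is a compact closed neighbourhood of its point. *)
move=> x _; exists [set x]; first by rewrite withinET; exact: discrete_set1.
by split; [exact: compact_set1|exact: discrete_closed].
Qed.

End discrete_one_point_compactification.

Lemma uncountable_set_nat : ~ countable [set: set nat].
Proof.
move=> /countable_injP [f fI].
(* Cantor's diagonal set: [f S] can lie neither inside nor outside [S]. *)
pose S := [set n | exists2 A, f A = n & ~ A n].
have nS : ~ S (f S).
  move=> /[dup] SfS [A fAS]; have -> : A = S by apply: fI; rewrite ?inE.
  exact.
by apply: (nS); exists S.
Qed.

Theorem proposition4p6 :
  exists X : topologicalType,
    regular_space X /\ accessible_space X /\ star_menger X /\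
    exists Y : set X, regopen Y /\ ~ star_menger (set_type Y).
Proof.
(* Two copies of the power set of [nat]: the [true] copy serves as [Y], and the [false] copy keeps
   its complement infinite. *)
pose D := discrete_topology (bool * set nat)%type.
pose T : pdiscreteTopologicalType :=
  HB.pack D (DiscreteTopology.on D) (Pointed.on D).
pose X : ptopologicalType := one_point_compactification T.
have hX : hausdorff_space X by exact: discrete_one_point_compactification_hausdorff.
have cX : compact [set: X] by exact: one_point_compactification_compact.
exists X; split; first by move=> x; exact: (compact_regular hX cX filterT).
split; first exact: hausdorff_accessible.
split; first exact: compact_star_menger.
have inj_pair (b : bool) : injective (pair b : set nat -> T) by move=> A B [].
exists (Some @` range (pair true : set nat -> T)); split.
  apply: regopen_Some => finC; apply: uncountable_set_nat.
  apply: finite_set_countable.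
  (* The [false] copy lies in the complement, so a finite complement would make [set nat] finite. *)
  have finF := finite_preimage (fun A B _ _ => @inj_pair false A B) finC.
  by apply: sub_finite_set finF => A _ [].
move=> /star_menger_set1_countable cY; apply: uncountable_set_nat.
have /countable_injP[f fI] : countable (Some @` range (pair true) : set X).
  by apply: cY => _ [t _ <-]; exact: open_Some1.
(* Composing with the embedding of the [true] copy turns the injection [f] into one on [set nat]. *)
apply/countable_injP; exists (fun A => f (Some (true, A))) => A B _ _ fAB.
have [] // : Some (true, A) = Some (true, B) :> X.
by apply: fI => //; rewrite inE; do 2 apply: imageP.
Qed.
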